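(* Let $\mathbb{K}$ be a field of characteristic zero and let $f=\frac{b}{c\,d^\lambda}\in\mathbb{K}(x,y,z)$, where $\lambda$ is a positive integer, $b,d\in\mathbb{K}[x,y,z]$, $c\in\mathbb{K}[x,y]$, $d$ is irreducible, $b,c,d$ are primitive as polynomials in $y,z$ (over $\mathbb{K}[x]$), and $\deg_z(b)<\deg_z(d)$. Suppose there is no positive integer $m$ such that $\sigma_x^m(d)=\sigma_y^n\sigma_z^k(d)$ for some $n,k\in\mathbb{Z}$. Then $f$ has a telescoper if and only if $f$ is $(\sigma_y,\sigma_z)$-summable.
   Context: $\sigma_x,\sigma_y,\sigma_z$ are the shift automorphisms of $\mathbb{K}(x,y,z)$: $\sigma_x(f)=f(x+1,y,z)$, $\sigma_y(f)=f(x,y+1,z)$, $\sigma_z(f)=f(x,y,z+1)$. A rational function $g\in\mathbb{K}(x,y,z)$ is $(\sigma_y,\sigma_z)$-summable if $g=\sigma_y(u)-u+\sigma_z(v)-v$ for some $u,v\in\mathbb{K}(x,y,z)$. A telescoper for $f$ is a nonzero operator $L=\sum_i \ell_i S_x^i$ with $\ell_i\in\mathbb{K}(x)$ such that $L(f)=\sum_i\ell_i f(x+i,y,z)$ is $(\sigma_y,\sigma_z)$-summable. *)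

(* Defs.v *)
From HB Require Import structures.
From mathcomp Require Import all_boot all_order all_algebra.
From mathcomp Require Import fraction.
Set Implicit Arguments. Unset Strict Implicit. Unset Printing Implicit Defensive.
Import GRing.Theory.
Local Open Scope ring_scope.

(* Trivariate polynomials K[x,y,z] are represented as nested univariate
   polynomials K[x][y][z] = {poly {poly {poly K}}}:
   innermost variable x, middle variable y, outermost variable z. *)
Notation poly3 K := {poly {poly {poly K}}}.
Notation rat3 K := {fraction poly3 K}.

Notation tofrac3 := (@FracField.tofrac _).
Local Notation "x %:F" := (tofrac3 x).

Section Defs.
Variable K : fieldType.

Definition shx (a : int) (r : {poly K}) : {poly K} := r \Po ('X + (a%:~R)%:P).

Definition shift3 (a b c : int) (p : poly3 K) : poly3 K :=
  (map_poly (fun q : {poly {poly K}} =>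
       (map_poly (shx a) q) \Po ('X + ((b%:~R : {poly K})%:P)))
     p) \Po ('X + ((c%:~R : {poly {poly K}})%:P)).

Definition shiftF (a b c : int) (f : rat3 K) : rat3 K :=
  let r := repr f in
  (shift3 a b c \n_r)%:F / (shift3 a b c \d_r)%:F.

Definition sigma_x := shiftF 1 0 0.
Definition sigma_y := shiftF 0 1 0.
Definition sigma_z := shiftF 0 0 1.

Definition yz_summable (g : rat3 K) : Prop :=
  exists u v : rat3 K, g = sigma_y u - u + sigma_z v - v.

Definition in_Kx (l : rat3 K) : Prop :=
  exists p q : {poly K}, q != 0 /\ l = (p%:P%:P)%:F / (q%:P%:P)%:F.

Definition apply_op (l : seq (rat3 K)) (f : rat3 K) : rat3 K :=
  \sum_(i < size l) l`_i * iter i sigma_x f.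

Definition has_telescoper (f : rat3 K) : Prop :=
  exists l : seq (rat3 K),
    (forall i, in_Kx l`_i) /\ (exists i, l`_i != 0) /\ yz_summable (apply_op l f).

Definition irreducible3 (d : poly3 K) : Prop :=
  d != 0 /\ d \isn't a GRing.unit /\
  forall u v : poly3 K, d = u * v -> u \is a GRing.unit \/ v \is a GRing.unit.

Definition yz_primitive (p : poly3 K) : Prop :=
  forall g : {poly K}, (forall i j, g %| p`_i`_j) -> (size g <= 1)%N.

Definition fbcd (b : poly3 K) (c : {poly {poly K}}) (d : poly3 K) (lam : nat)
  : rat3 K := b%:F / ((c%:P)%:F * (d%:F) ^+ lam).
End Defs.

(* Main.v *)
(** Let T be the orbit of a shift d_j = sigma_x^j(d) under the group generated by
    sigma_y and sigma_z.  Its elements are primes of K[x,y,z] of positive degree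
    in z, so K(x,y,z) is the direct sum of the space of fractions that are proper
    in z with denominator r * t_1 ... t_n, where r is in K[x,y] and the t_i are
    in T, and the space of fractions whose denominator has no factor in T.  Both
    spaces are stable under sigma_y and sigma_z.  Since no sigma_x^m(d), m > 0,
    is in the orbit of d, the component of L(f) in the first space is
    l_j * sigma_x^j(f), which is therefore summable whenever L(f) is.  As l_j is
    fixed by sigma_y and sigma_z and sigma_x commutes with them, f itself is
    summable as soon as some l_j is nonzero. *)
Require Import Defs.
From HB Require Import structures.
From mathcomp Require Import all_boot all_order all_algebra.
From mathcomp Require Import fraction.
From mathcomp Require Import ring.
From Stdlib Require Import Classical.
Set Implicit Arguments.
Unset Strict Implicit.
Unset Printing Implicit Defensive.
Import GRing.Theory.
Local Open Scope ring_scope.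

Local Notation "x %:F" := (FracField.tofrac x).

(** * Unique factorization in polynomial rings *)

Section Divisibility.
Variable R : idomainType.
Implicit Types a b c p : R.

Definition divides a b := exists c, b = a * c.

Definition prime_elt p :=
  [/\ p != 0, p \isn't a GRing.unit &
      forall a b, divides p (a * b) -> divides p a \/ divides p b].

Inductive prime_product : R -> Prop :=
| prime_product_unit u : u \is a GRing.unit -> prime_product u
| prime_product_mul p a :
    prime_elt p -> prime_product a -> prime_product (p * a).

(** Factorizations are into primes rather than irreducibles, so their existence alone already
    implies uniqueness. *)
Definition factorial_ring := forall a, a != 0 -> prime_product a.

Lemma divides_mulr a b c : divides a b -> divides a (b * c).
Proof. by case=> e ->; exists (e * c); rewrite mulrA. Qed.

Lemma divides_mull a b c : divides a b -> divides a (c * b).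
Proof. by rewrite mulrC; apply: divides_mulr. Qed.

Lemma divides_trans a b c : divides a b -> divides b c -> divides a c.
Proof. by move=> ab [e ->]; apply: divides_mulr. Qed.

Lemma divides_unit a b : divides a b -> b \is a GRing.unit -> a \is a GRing.unit.
Proof. by case=> c ->; rewrite unitrM => /andP[]. Qed.

Lemma prime_mul_unit p u :
  u \is a GRing.unit -> prime_elt p -> prime_elt (p * u).
Proof.
move=> Uu [p0 nUp pP].
have dE x : divides (p * u) x <-> divides p x.
  split=> [|[c ->]]; first by case=> c ->; exists (u * c); rewrite mulrA.
  by exists (u^-1 * c); rewrite -mulrA mulVKr.
split; first by rewrite mulf_neq0 //; apply: contraTneq Uu => ->; rewrite unitr0.
  by rewrite unitrM (negbTE nUp).
by move=> a b /dE/pP; rewrite !dE.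
Qed.

Lemma prime_divides_prime p q :
  prime_elt p -> prime_elt q -> divides p q -> divides q p.
Proof.
move=> [_ nUp _] [q0 nUq qP] [w qE].
(* If [q] divided the cofactor [w] of [p] in [q], cancelling [q] would make [p] a unit. *)
have /qP[//|[v wE]] : divides q (p * w) by exists 1; rewrite mulr1.
case/negP: nUp; apply/unitrP; exists v.
have : q * 1 = q * (p * v) by rewrite mulr1 {1}qE wE; ring.
by move/(mulfI q0); rewrite (mulrC v) => <-.
Qed.

Lemma prime_productM a b :
  prime_product a -> prime_product b -> prime_product (a * b).
Proof.
move=> + ppb; elim=> [u Uu|p c pp _ IH]; last first.
  by rewrite -mulrA; apply: prime_product_mul.
case: ppb => [v Uv|p c pp ppc]; first by apply: prime_product_unit; rewrite unitrM Uu.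
by rewrite mulrA (mulrC u); apply: prime_product_mul => //; apply: prime_mul_unit.
Qed.

Lemma prime_product_prime_divisor a :
  prime_product a -> a \isn't a GRing.unit ->
  exists2 p, prime_elt p & divides p a.
Proof.
case=> [u ->//|p b pp _ _]; exists p => //; by exists b.
Qed.

Lemma irreducible_prime (facR : factorial_ring) d :
  d != 0 -> d \isn't a GRing.unit ->
  (forall u v, d = u * v -> u \is a GRing.unit \/ v \is a GRing.unit) ->
  prime_elt d.
Proof.
move=> /facR; case=> [u ->//|p b pp _ _ irr].
case: (pp) => _ nUp _.
by case: (irr p b erefl) => [/(negP nUp)//|Ub]; apply: prime_mul_unit.
Qed.

End Divisibility.

Lemma field_factorial (F : fieldType) : factorial_ring F.
Proof. by move=> a a0; apply: prime_product_unit; rewrite unitfE. Qed.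

(** * Gauss's lemma: factoriality passes from [R] to [R[X]] *)

Section Polynomials.
Variable R : idomainType.
Implicit Types (a c r : R) (p q f g : {poly R}).

Lemma divides_polyC a p : divides a%:P p <-> forall i, divides a p`_i.
Proof.
split=> [[q ->] i|H]; first by exists q`_i; rewrite coefCM.
elim/poly_ind: p H => [|p b IH] H; first by exists 0; rewrite mulr0.
have [|q ->] := IH; last first.
  have := H 0; rewrite coefD coefMX coefC eqxx add0r => -[e ->].
  by exists (q * 'X + e%:P); rewrite mulrDr mulrA rmorphM.
by move=> i; have := H i.+1; rewrite coefD coefMX coefC addr0.
Qed.

(** Constant terms are stripped one at a time. If [a] divides the constant term [b] of the first
    factor, that term is dropped and the induction on [p] applies; otherwise [a] divides the
    constant term of the second factor, which is dropped by induction on [q]. *)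
Lemma prime_polyC a : prime_elt a -> prime_elt a%:P.
Proof.
move=> [a0 nUa aP]; split; first by rewrite polyC_eq0.
  by rewrite poly_unitE coefC (negbTE nUa) andbF.
move=> p q; elim/poly_ind: p q => [|p b IHp] q dpq.
  by left; exists 0; rewrite mulr0.
have addK (x y : {poly R}) : divides a%:P x -> divides a%:P (x + y) -> divides a%:P y.
  by move=> [e ->] [e' E]; exists (e' - e); rewrite mulrBr -E; ring.
have [ab|nab] := classic (divides a b).
  have dbP : divides a%:P b%:P by case: ab => e ->; exists e%:P; rewrite rmorphM.
  have dX : divides a%:P (p * q * 'X).
    apply: (addK (b%:P * q)); first exact: divides_mulr.
    by have -> : b%:P * q + p * q * 'X = (p * 'X + b%:P) * q by ring.
  have /IHp[] : divides a%:P (p * q).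
    apply/divides_polyC => i; have/divides_polyC/(_ i.+1) := dX.
    by rewrite coefMX.
  - move=> dp; left; apply/divides_polyC; case=> [|i].
      by rewrite coefD coefMX coefC add0r.
    by rewrite coefD coefMX coefC addr0 /=; move/divides_polyC: dp.
  - by right.
right; elim/poly_ind: q dpq => [|q e IHq] dpq; first by exists 0; rewrite mulr0.
have de : divides a e.
  have /divides_polyC/(_ 0) := dpq.
  rewrite coef0M !coefD !coefMX !coefC /= !add0r => /aP[//|//].
have deP : divides a%:P e%:P by case: de => x ->; exists x%:P; rewrite rmorphM.
have /IHq dq : divides a%:P ((p * 'X + b%:P) * q).
  have dX : divides a%:P ((p * 'X + b%:P) * q * 'X).
    apply: (addK ((p * 'X + b%:P) * e%:P)); first exact: divides_mull.
    by have -> : (p * 'X + b%:P) * e%:P + (p * 'X + b%:P) * q * 'X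
       = (p * 'X + b%:P) * (q * 'X + e%:P) by ring.
  apply/divides_polyC => i; have/divides_polyC/(_ i.+1) := dX.
  by rewrite coefMX.
case: dq deP => x -> [y ->]; exists (x * 'X + y); ring.
Qed.

Definition primitive_poly p := forall a, prime_elt a -> ~ divides a%:P p.

(** Each prime factor of [r] divides [p * g] but not the primitive [p], so it divides [g] and
    cancels. This brings divisibility over the fraction field back to [R[X]]. *)
Lemma primitive_cancel r p f g :
  prime_product r -> primitive_poly p -> r%:P * f = p * g -> divides p f.
Proof.
move=> ppr prim; elim: ppr g => [u Uu|a b pa _ IH] g.
  move=> E; exists (u^-1%:P * g).
  by rewrite mulrCA -E mulrA -rmorphM mulVr // mul1r.
rewrite rmorphM -mulrA => E.
have [_ _ /(_ p g) paP] := prime_polyC pa.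
have [/(prim _ pa)//|[h gE]] : divides a%:P p \/ divides a%:P g.
  by apply: paP; exists (b%:P * f); rewrite E.
apply: (IH h); apply: (@mulfI _ a%:P); first by case: (prime_polyC pa).
by rewrite E gE; ring.
Qed.

Hypothesis facR : factorial_ring R.

Lemma content_decomposition p : p != 0 ->
  exists c q, [/\ c != 0, p = c%:P * q & primitive_poly q].
Proof.
(* Every prime dividing [p] divides its leading coefficient, whose factorization drives the
   induction. The part [l] is still to be examined; no prime divisor of [m] divides [p] any more. *)
suff H (l : R) : prime_product l -> forall p (m : R), p != 0 ->
    lead_coef p = l * m ->
    (forall a, prime_elt a -> divides a m -> ~ divides a%:P p) ->
    exists c q, [/\ c != 0, p = c%:P * q & primitive_poly q].
  move=> p0; apply: (H (lead_coef p) _ p 1) => //; rewrite ?mulr1 //.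
    by apply: facR; rewrite lead_coef_eq0.
  by move=> a [_ nU _] /divides_unit/(_ (unitr1 _)); rewrite (negbTE nU).
elim=> {p} [u Uu|a b pa _ IH] p m p0 lE mP.
  exists 1, p; split; rewrite ?oner_neq0 ?mul1r // => a pa dap.
  apply: (mP a pa) => //.
  have [e E] : divides a (u * m).
    by rewrite -lE lead_coefE; move/divides_polyC: dap; apply.
  by exists (u^-1 * e); rewrite mulrCA -E mulKr.
have a0 : a != 0 by case: pa.
have [[p1 pE]|ndap] := classic (divides a%:P p).
  have p10 : p1 != 0 by apply: contraNneq p0 => E; rewrite pE E mulr0.
  have [] := IH p1 m p10.
  - by apply: (mulfI a0); rewrite mulrA -lE pE lead_coefM lead_coefC.
  - move=> a' pa' am dp1; apply: (mP a' pa' am).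
    by rewrite pE; apply: divides_mull.
  move=> c [q [c0 qE qP]]; exists (a * c), q; split=> //.
    by rewrite mulf_neq0.
  by rewrite pE qE rmorphM mulrA.
apply: (IH p (a * m)) => //; first by rewrite lE; ring.
move=> a' pa' da' da'p; have [_ _ a'P] := pa'.
have [|/(mP _ pa')//] := a'P _ _ da'.
move/(prime_divides_prime pa' pa) => [x aE]; apply: ndap.
by apply: divides_trans da'p; exists x%:P; rewrite -rmorphM -aE.
Qed.

Lemma size1_divides_unit p q : primitive_poly p -> p != 0 ->
  divides q p -> (size q <= 1)%N -> q \is a GRing.unit.
Proof.
move=> prim p0 qp /size1_polyC qE; rewrite qE in qp *.
have q0 : q`_0 != 0 by apply: contraNneq p0 => E; case: qp => x ->; rewrite E mul0r.
apply: contraT; rewrite poly_unitE coefC size_polyC q0 eqxx /= => nU.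
have [a pa daq] := prime_product_prime_divisor (facR q0) nU.
case: (prim a pa); apply: divides_trans qp.
by case: daq => x ->; exists x%:P; rewrite rmorphM.
Qed.

(** Let [p] divide [f * g]. If [p] and [f] are coprime over the fraction field, a Bezout relation
    multiplied by [g] shows that [p] divides a constant multiple of [g]. Otherwise the primitive
    part of their gcd divides both in [R[X]], and irreducibility makes it an associate of [p]. *)
Lemma irreducible_primitive_prime p :
  p != 0 -> p \isn't a GRing.unit -> primitive_poly p ->
  (forall u v, p = u * v -> u \is a GRing.unit \/ v \is a GRing.unit) ->
  prime_elt p.
Proof.
move=> p0 nUp prim irr; split=> // f g [h fgE].
have [cop|ncop] := boolP (coprimep p f).
  right; have /Bezout_coprimepP[[u v] /eqpP[[c1 c2] /= /andP[c10 c20]]] := cop.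
  rewrite -!mul_polyC mulr1 => E.
  apply: (@primitive_cancel c2 _ _ (c1%:P * (u * g + v * h))) => //; first exact: facR.
  rewrite -E; have -> : c1%:P * (u * p + v * f) * g = c1%:P * (u * p * g + v * (f * g)) by ring.
  by rewrite fgE; ring.
left; set d := gcdp p f.
have d0 : d != 0 by rewrite gcdp_eq0 (negbTE p0).
have [c [d1 [c0 dE d1P]]] := content_decomposition d0.
have d1dvd x : d %| x -> divides d1 x.
  case/Pdiv.Idomain.dvdpP => -[r y] /= r0; rewrite -mul_polyC => E.
  apply: (@primitive_cancel r _ _ (y * c%:P)) => //; first exact: facR.
  by rewrite E dE; ring.
have [h1 pE] := d1dvd _ (dvdp_gcdl p f).
have [k ->] := d1dvd _ (dvdp_gcdr p f).
case: (irr _ _ pE) => [Ud1|Uh1].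
  case/negP: ncop; rewrite coprimep_def -/d dE size_mul ?polyC_eq0 //.
    by rewrite size_polyC c0; move: Ud1; rewrite poly_unitE => /andP[/eqP-> _].
  by apply: contraNneq d0 => E; rewrite dE E mulr0.
by exists (h1^-1 * k); rewrite pE -mulrA mulVKr.
Qed.

Lemma prime_product_polyC c : prime_product c -> prime_product c%:P.
Proof.
elim=> [u Uu|a b pa _ IH].
  have u0 : u != 0 by apply: contraTneq Uu => ->; rewrite unitr0.
  by apply: prime_product_unit; rewrite poly_unitE coefC Uu size_polyC u0.
by rewrite rmorphM; apply: prime_product_mul => //; apply: prime_polyC.
Qed.

(** The content factors in [R]. The primitive part is a unit, or irreducible and hence prime, or a
    product of two factors; these are nonconstant or the constant one would be a unit, so both are
    smaller and the induction on size applies. *)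
Theorem poly_factorial : factorial_ring {poly R}.
Proof.
move=> p; have [n] := ubnP (size p); elim: n p => // n IH p szp p0.
have [c [q [c0 pE prim]]] := content_decomposition p0.
rewrite pE; apply: prime_productM.
  by apply: prime_product_polyC; apply: facR.
have q0 : q != 0 by apply: contraNneq p0 => E; rewrite pE E mulr0.
have szq : size q = size p by rewrite pE mul_polyC size_scale.
have [Uq|nUq] := boolP (q \is a GRing.unit); first exact: prime_product_unit.
have [irr|] := classic (forall u v, q = u * v -> u \is a GRing.unit \/ v \is a GRing.unit).
  rewrite -[q]mulr1; apply: prime_product_mul.
    exact: irreducible_primitive_prime.
  exact/prime_product_unit/unitr1.
move=> /not_all_ex_not[u /not_all_ex_not[v nH]].
have [qE nU] := imply_to_and _ _ nH.
have /andP[u0 v0] : (u != 0) && (v != 0) by rewrite -negb_or -mulf_eq0 -qE.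
have szu : (1 < size u)%N.
  rewrite ltnNge; apply/negP=> /(size1_divides_unit prim q0) Uu.
  by apply: nU; left; apply: Uu; exists v.
have szv : (1 < size v)%N.
  rewrite ltnNge; apply/negP=> /(size1_divides_unit prim q0) Uv.
  by apply: nU; right; apply: Uv; exists u; rewrite mulrC.
have szE : size q = (size u + size v).-1 by rewrite qE size_mul.
move: szp; rewrite -szq szE ltnS.
case: (size u) szu (IH u) => [|[|k]] // _ IHu.
case: (size v) szv (IH v) => [|[|l]] // _ IHv le.
rewrite qE; apply: prime_productM; [apply: IHu|apply: IHv] => //.
  by apply: leq_trans le; rewrite !addSn !addnS /= !ltnS leq_addr.
by apply: leq_trans le; rewrite !addSn !addnS /= !ltnS leq_addl.
Qed.

End Polynomials.

(** * Decomposition of rational functions along a set of primes *)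

Lemma fraction_repr (R : idomainType) (x : {fraction R}) :
  (\n_(repr x))%:F / (\d_(repr x))%:F = x.
Proof.
apply: esym; have d0 := denom_ratioP (repr x).
apply: (@mulIf _ (\d_(repr x))%:F); first by rewrite tofrac_eq0.
rewrite mulfVK ?tofrac_eq0 // -{1}[x]reprK.
case: (repr x) d0 => -[n d] /= dd0 _.
unlock FracField.tofrac; rewrite -[_ * _]FracField.pi_mul.
apply/eqP; rewrite FracField.equivf_def.
by rewrite !numden_Ratio ?mulr1 ?oner_neq0 //= mulrC.
Qed.

Lemma fraction_ind (R : idomainType) (P : {fraction R} -> Prop) :
  (forall a b : R, b != 0 -> P (a%:F / b%:F)) -> forall x, P x.
Proof. by move=> H x; rewrite -(fraction_repr x); apply/H/denom_ratioP. Qed.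

Lemma frac_eqE (R : idomainType) (a b c d : R) : b != 0 -> d != 0 ->
  (a%:F / b%:F == c%:F / d%:F) = (a * d == c * b).
Proof. by move=> b0 d0; rewrite eqr_div ?tofrac_eq0 // -!tofracM tofrac_eq. Qed.

Lemma frac_repr_cross (R : idomainType) (a b : R) : b != 0 ->
  \n_(repr (a%:F / b%:F)) * b = a * \d_(repr (a%:F / b%:F)).
Proof.
by move=> b0; apply/eqP; rewrite -frac_eqE ?fraction_repr // denom_ratioP.
Qed.

(** Used to show that a map defined through the chosen representative [repr] does not depend on that
    choice. *)
Lemma frac_map_cross (R S : idomainType) (f : {rmorphism R -> S}) (a b c d : R) :
  f b != 0 -> f d != 0 -> a * d = c * b ->
  (f a)%:F / (f b)%:F = (f c)%:F / (f d)%:F.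
Proof.
by move=> b0 d0 E; apply/eqP; rewrite frac_eqE // -!rmorphM E.
Qed.

Lemma frac_subE (R : idomainType) (a b c d : R) : b != 0 -> d != 0 ->
  a%:F / b%:F - c%:F / d%:F = (a * d - c * b)%:F / (b * d)%:F.
Proof.
move=> b0 d0; rewrite -mulNr -tofracN addf_div ?tofrac_eq0 //.
by rewrite -!tofracM -tofracD mulNr.
Qed.

Lemma frac_mulE (R : idomainType) (a b c d : R) :
  a%:F / b%:F * (c%:F / d%:F) = (a * c)%:F / (b * d)%:F.
Proof. by rewrite mulf_div -!tofracM. Qed.

Section FractionMaps.
Variables (R : idomainType) (phi : {rmorphism R -> R}) (Phi : {fraction R} -> {fraction R}).
Hypothesis phi_neq0 : forall a, a != 0 -> phi a != 0.
Hypothesis PhiE : forall a b, b != 0 -> Phi (a%:F / b%:F) = (phi a)%:F / (phi b)%:F.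

Lemma fraction_mapB u v : Phi (u - v) = Phi u - Phi v.
Proof.
elim/fraction_ind: u => a b b0; elim/fraction_ind: v => c d d0.
by rewrite frac_subE // !PhiE ?mulf_neq0 // frac_subE ?phi_neq0 // rmorphB !rmorphM.
Qed.

Lemma fraction_mapM u v : Phi (u * v) = Phi u * Phi v.
Proof.
elim/fraction_ind: u => a b b0; elim/fraction_ind: v => c d d0.
by rewrite frac_mulE !PhiE ?mulf_neq0 // frac_mulE !rmorphM.
Qed.

End FractionMaps.

Lemma divides_size (R : idomainType) (p q : {poly R}) :
  q != 0 -> divides p q -> (size p <= size q)%N.
Proof. by move=> q0 [k qE]; apply: dvdp_leq => //; rewrite qE dvdp_mulr. Qed.

Definition difference_form (V : zmodType) (Phi Psi : V -> V) (g : V) :=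
  exists u v, g = Phi u - u + Psi v - v.

Lemma difference_form_map (V : zmodType) (Phi Psi S : V -> V) g :
  (forall u v, S (u - v) = S u - S v) ->
  (forall u, S (Phi u) = Phi (S u)) -> (forall u, S (Psi u) = Psi (S u)) ->
  difference_form Phi Psi g -> difference_form Phi Psi (S g).
Proof.
move=> SB SPhi SPsi [u [v ->]]; exists (S u), (S v).
have -> : Phi u - u + Psi v - v = (Phi u - u) - (v - Psi v).
  by rewrite opprB addrA.
by rewrite !SB SPhi SPsi opprB addrA.
Qed.

Section Decomposition.
Variable R : idomainType.
Variable T : {poly R} -> Prop.
Hypothesis T_prime : forall t, T t -> prime_elt t.
Hypothesis T_size : forall t, T t -> (1 < size t)%N.
Implicit Types (a b q t p : {poly R}) (r : R) (u v w : {fraction {poly R}}).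

Inductive T_product : {poly R} -> Prop :=
| T_product_one : T_product 1
| T_product_mul t p : T t -> T_product p -> T_product (t * p).

Definition T_free q := q != 0 /\ forall t, T t -> ~ divides t q.

(** The factor [r] is invertible over the fraction field of [R], so such factors are allowed in the
    denominators of both parts. *)
Definition T_part u := exists a r p,
  [/\ r != 0, T_product p, (size a < size p)%N & u = a%:F / (r%:P * p)%:F].

Definition T_free_part u := exists a q, T_free q /\ u = a%:F / q%:F.

Lemma T_product_neq0 p : T_product p -> p != 0.
Proof.
elim=> [|t q Tt _ q0]; first exact: oner_neq0.
by rewrite mulf_neq0 //; case: (T_prime Tt).
Qed.

Lemma T_productM p q : T_product p -> T_product q -> T_product (p * q).
Proof.
move=> + Tq; elim=> [|t q' Tt _ IH]; first by rewrite mul1r.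
by rewrite -mulrA; apply: T_product_mul.
Qed.

Lemma T_product_exp t n : T t -> T_product (t ^+ n).
Proof.
move=> Tt; elim: n => [|n IH]; first exact: T_product_one.
by rewrite exprS; apply: T_product_mul.
Qed.

Lemma T_freeM p q : T_free p -> T_free q -> T_free (p * q).
Proof.
move=> [p0 Fp] [q0 Fq]; split=> [|t Tt]; first exact: mulf_neq0.
by have [_ _ tP] := T_prime Tt; move=> /tP[/(Fp t Tt)|/(Fq t Tt)].
Qed.

Lemma T_freeC r : r != 0 -> T_free r%:P.
Proof.
rewrite -polyC_eq0 => r0; split=> // t Tt /(divides_size r0).
by rewrite leqNgt size_polyC (leq_ltn_trans _ (T_size Tt)) // leq_b1.
Qed.

Lemma T_product_divides p a q b :
  T_product p -> T_free q -> a * q = b * p -> divides p a.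
Proof.
move=> Tp [q0 Fq]; elim: Tp a b => [|t p' Tt _ IH] a b E.
  by exists a; rewrite mul1r.
have [t0 _ tP] := T_prime Tt.
have [[a' aE]|/(Fq t Tt)//] : divides t a \/ divides t q.
  by apply: tP; exists (b * p'); rewrite E; ring.
have [|x a'E] := IH a' b; last by exists x; rewrite aE a'E mulrA.
by apply: (mulfI t0); rewrite mulrA -aE E; ring.
Qed.

(** Over [R], the gcd [g] satisfies [s t = y g] and [s' q = y' g] with nonzero constants [s], [s'].
    The prime [t] divides [y] or [g]: in the first case [g] divides [s] and is constant; in the
    second [t] would divide [s' q], hence [s'] or [q]. *)
Lemma T_free_coprime t q : T t -> T_free q -> coprimep q t.
Proof.
move=> Tt [q0 Fq]; have [t0 _ tP] := T_prime Tt.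
rewrite coprimep_def; set g := gcdp q t.
have /Pdiv.Idomain.dvdpP[[s y] /= s0] := dvdp_gcdr q t; rewrite -/g -mul_polyC => E.
have /Pdiv.Idomain.dvdpP[[s' y'] /= s'0] := dvdp_gcdl q t; rewrite -/g -mul_polyC => E'.
have sC k : k != 0 -> ~ divides t k%:P by move/T_freeC=> [_]; apply.
have : divides t (y * g) by exists s%:P; rewrite -E mulrC.
have yg0 : (y != 0) && (g != 0).
  by rewrite -negb_or -mulf_eq0 -E mulf_neq0 // polyC_eq0.
case/andP: yg0 => y0 g0.
case/tP=> [[k yE]|dg].
  have sE : s%:P = k * g by apply: (mulfI t0); rewrite mulrC E yE mulrA.
  rewrite eqn_leq size_poly_gt0 g0 andbT.
  apply: leq_trans (_ : size s%:P <= 1)%N; last by rewrite size_polyC leq_b1.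
  apply: divides_size; first by rewrite polyC_eq0.
  by rewrite sE; apply: divides_mull; exists 1; rewrite mulr1.
have : divides t (s'%:P * q) by rewrite E'; apply: divides_mull.
by case/tP=> [/(sC _ s'0)//|/(Fq t Tt)].
Qed.

Lemma T_free_bezout p q : T_product p -> T_free q ->
  exists a b r, r != 0 /\ a * q + b * p = r%:P.
Proof.
move=> Tp Fq; elim: Tp => [|t p' Tt _ [a [b [r [r0 E]]]]].
  by exists 0, 1, 1; rewrite oner_neq0 mul0r add0r mulr1.
have /Bezout_coprimepP[[x y] /eqpP[[c1 c2] /= /andP[c10 c20]]] := T_free_coprime Tt Fq.
rewrite -!mul_polyC mulr1 => E'.
(* The product of the relations [a q + b p' = r] and [c1 (x q + y t) = c2], with the terms sorted
   into multiples of [q] and of [t p']. *)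
exists (a * c1%:P * (x * q + y * t) + b * p' * c1%:P * x), (b * c1%:P * y), (r * c2).
by rewrite mulf_neq0 // polyCM -E -E'; split=> //; ring.
Qed.

Lemma T_factorization q : q != 0 ->
  exists q' p, [/\ T_free q', T_product p & q = q' * p].
Proof.
have [n] := ubnP (size q); elim: n q => // n IH q szq q0.
have [Fq|] := classic (T_free q).
  by exists q, 1; split; rewrite ?mulr1 //; apply: T_product_one.
move=> nF; have [t nTt] : exists t, ~ (T t -> ~ divides t q).
  by apply: not_all_ex_not => H; apply: nF.
have [Tt /NNPP[k qE]] := imply_to_and _ _ nTt.
have k0 : k != 0 by apply: contraNneq q0 => E; rewrite qE E mulr0.
have [t0 _ _] := T_prime Tt.
have [||q' [p [Fq' Tp kE]]] := IH k => //.
  have := T_size Tt; move: szq; rewrite qE size_mul //.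
  case: (size t) => [|[|l]] //= szq _.
  by move: szq; rewrite !addSn /= !ltnS; apply: leq_trans; rewrite ltnS leq_addl.
exists q', (t * p); split=> //; first exact: T_product_mul.
by rewrite qE kE mulrCA.
Qed.

Lemma T_partB u v : T_part u -> T_part v -> T_part (u - v).
Proof.
move=> [a [r [p [r0 Tp sa ->]]]] [b [s [q [s0 Tq sb ->]]]].
have [p0 q0] := (T_product_neq0 Tp, T_product_neq0 Tq).
(* A proper fraction stays proper when expanded by [z] and when its numerator is multiplied by a
   constant. *)
have size_lt (x c y z : {poly R}) k : y != 0 -> z != 0 -> (size x < size y)%N ->
    (size (x * z * k%:P)%R < size (y * z)%R)%N.
  move=> y0 z0 lt.
  apply: (@leq_ltn_trans (size (x * z)%R)).
    by rewrite mulrC mul_polyC; apply: size_scale_leq.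
  have [->|x0] := eqVneq x 0; first by rewrite mul0r size_poly0 size_poly_gt0 mulf_neq0.
  rewrite !size_mul //; case: (size z) (size_poly_eq0 z) => [|m _]; first by rewrite (negbTE z0).
  by rewrite !addnS /= ltn_add2r.
exists (a * q * s%:P - b * p * r%:P), (r * s), (p * q); split.
- exact: mulf_neq0.
- exact: T_productM.
- apply: leq_ltn_trans (size_polyD _ _) _.
  rewrite size_polyN gtn_max !size_lt //.
  by rewrite (mulrC p) size_lt.
rewrite frac_subE ?mulf_neq0 ?polyC_eq0 // polyCM.
by congr (_%:F / _%:F); ring.
Qed.

Lemma T_partZ (c d : R) u : d != 0 -> T_part u -> T_part (c%:P%:F / d%:P%:F * u).
Proof.
move=> d0 [a [r [p [r0 Tp sa ->]]]]; exists (c%:P * a), (d * r), p; split=> //.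
- exact: mulf_neq0.
- by apply: leq_ltn_trans sa; rewrite mul_polyC size_scale_leq.
by rewrite frac_mulE polyCM mulrA.
Qed.

Lemma T_free_partB u v : T_free_part u -> T_free_part v -> T_free_part (u - v).
Proof.
move=> [a [q [Fq ->]]] [b [s [Fs ->]]]; exists (a * s - b * q), (q * s).
split; first exact: T_freeM.
by case: Fq Fs => q0 _ [s0 _]; rewrite frac_subE.
Qed.

(** If [a / (r p) = b / q] with [q] free of [T], then [p] divides [a], which is impossible for a
    nonzero [a] smaller than [p]. *)
Lemma T_part_uniq u : T_part u -> T_free_part u -> u = 0.
Proof.
move=> [a [r [p [r0 Tp sa ->]]]] [b [q [Fq E]]].
have p0 := T_product_neq0 Tp.
have q0 : q != 0 by case: Fq.
move/eqP: E; rewrite frac_eqE ?mulf_neq0 ?polyC_eq0 //.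
rewrite mulrA => /eqP/(T_product_divides Tp Fq)[k aE].
suff -> : a = 0 by rewrite tofrac0 mul0r.
have [//|a0] := eqVneq a 0; move: sa; rewrite ltnNge => /negP[].
by apply: divides_size => //; exists k.
Qed.

(** Partial fractions: [a q + b p = r] gives [n / (q p) = n a / (r p) + n b / (r q)], and
    pseudo-division of [n a] by [p] makes the first term proper. *)
Lemma T_decomposition u : exists v w, [/\ T_part v, T_free_part w & u = v + w].
Proof.
elim/fraction_ind: u => n d d0.
have [q [p [Fq Tp ->]]] := T_factorization d0.
have [p0 q0] : p != 0 /\ q != 0 by case: Fq => q0 _; split=> //; apply: T_product_neq0.
have [a [b [r [r0 E]]]] := T_free_bezout Tp Fq.
have := Pdiv.Idomain.divp_eq (n * a) p.
set s := (_ ^+ _); set k := _ %/ p; set m := _ %% p; rewrite -mul_polyC => E'.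
have s0 : s != 0 by rewrite expf_neq0 // lead_coef_eq0.
(* With [s n a = k p + m], the polynomial part [k / (s r)] joins the [T]-free summand. *)
exists (m%:F / ((s * r)%:P * p)%:F), ((k * q + n * b * s%:P)%:F / ((s * r)%:P * q)%:F); split.
- exists m, (s * r), p; split=> //; first exact: mulf_neq0.
  by rewrite Pdiv.CommonIdomain.ltn_modp.
- by exists (k * q + n * b * s%:P), ((s * r)%:P * q); split=> //; apply: T_freeM Fq; apply/T_freeC/mulf_neq0.
have sr0 : (s * r)%:P != 0 by rewrite polyC_eq0 mulf_neq0.
rewrite addf_div ?tofrac_eq0 ?mulf_neq0 // -!tofracM -tofracD.
apply/eqP; rewrite frac_eqE ?mulf_neq0 //.
have mE : m = s%:P * (n * a) - k * p by rewrite E'; ring.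
by apply/eqP; rewrite mE !polyCM -E; ring.
Qed.

Lemma T_free_part0 : T_free_part 0.
Proof.
exists 0, 1; split; last by rewrite tofrac0 mul0r.
exact/T_freeC/oner_neq0.
Qed.

Lemma T_free_partD u v : T_free_part u -> T_free_part v -> T_free_part (u + v).
Proof.
by move=> Fu Fv; rewrite -[v]opprK -[- v]sub0r; do !apply: T_free_partB => //; apply: T_free_part0.
Qed.

Lemma T_free_part_sum (I : Type) (s : seq I) (P : pred I) (G : I -> {fraction {poly R}}) :
  (forall i, P i -> T_free_part (G i)) -> T_free_part (\sum_(i <- s | P i) G i).
Proof. by move=> H; apply: big_ind => //; [apply: T_free_part0|apply: T_free_partD]. Qed.

Lemma T_part_frac a r t n : r != 0 -> T t -> (size a < size t)%N -> (0 < n)%N ->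
  T_part (a%:F / (r%:P * t ^+ n)%:F).
Proof.
move=> r0 Tt sa n0; exists a, r, (t ^+ n); split=> //; first exact: T_product_exp.
apply: leq_trans sa _; apply: divides_size.
  exact/T_product_neq0/T_product_exp.
by exists (t ^+ n.-1); rewrite -exprS prednK.
Qed.

Lemma T_free_part_frac a r q n : r != 0 -> T_free q ->
  T_free_part (a%:F / (r%:P * q ^+ n)%:F).
Proof.
move=> r0 Fq; exists a, (r%:P * q ^+ n); split=> //.
apply: T_freeM; first exact: T_freeC.
elim: n => [|n IH]; first exact/T_freeC/oner_neq0.
by rewrite exprS; apply: T_freeM.
Qed.

Lemma T_free_partZ (c d : R) u :
  d != 0 -> T_free_part u -> T_free_part (c%:P%:F / d%:P%:F * u).
Proof.
move=> d0 [a [q [Fq ->]]]; exists (c%:P * a), (d%:P * q).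
by rewrite frac_mulE; split=> //; apply: T_freeM => //; apply: T_freeC.
Qed.

Definition T_stable (Phi : {fraction {poly R}} -> {fraction {poly R}}) :=
  [/\ forall u v, Phi (u - v) = Phi u - Phi v,
      forall u, T_part u -> T_part (Phi u) &
      forall u, T_free_part u -> T_free_part (Phi u)].

Lemma T_stable_map (phi psi : {rmorphism {poly R} -> {poly R}}) Phi :
  (forall a b, b != 0 -> Phi (a%:F / b%:F) = (phi a)%:F / (phi b)%:F) ->
  (forall p, size (phi p) = size p) ->
  (forall r, exists r', phi r%:P = r'%:P) ->
  cancel phi psi -> (forall t, T t -> T (phi t)) -> (forall t, T t -> T (psi t)) ->
  T_stable Phi.
Proof.
move=> PhiE szE phiC phiK Tphi Tpsi.
have phi0 a : a != 0 -> phi a != 0 by rewrite -!size_poly_eq0 szE.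
split=> [||u]; first exact: fraction_mapB PhiE.
  move=> _ [a [r [p [r0 Tp sa ->]]]]; have [r' r'E] := phiC r.
  exists (phi a), r', (phi p); split; rewrite ?szE //.
  - by rewrite -polyC_eq0 -r'E phi0 // polyC_eq0.
  - elim: Tp => [|t q Tt _ IH]; first by rewrite rmorph1; apply: T_product_one.
    by rewrite rmorphM; apply: T_product_mul IH; apply: Tphi.
  - by rewrite PhiE ?mulf_neq0 ?polyC_eq0 ?T_product_neq0 // rmorphM r'E.
case=> a [q [[q0 Fq] ->]]; exists (phi a), (phi q).
rewrite PhiE //; split=> //; split=> [|t Tt [k E]]; first exact: phi0.
(* If [t] divides [phi q], then [psi t], again in [T], divides [q]. *)
by apply: (Fq _ (Tpsi t Tt)); exists (psi k); rewrite -rmorphM -E phiK.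
Qed.

(* Both summands of the decomposition are stable under [Phi] and [Psi], so the
   [T]-part of [g] is obtained from the [T]-parts of [u] and [v]. *)
Lemma T_part_difference Phi Psi g h :
  T_stable Phi -> T_stable Psi -> T_part g -> T_free_part h ->
  difference_form Phi Psi (g + h) -> difference_form Phi Psi g.
Proof.
move=> [PhiB PhiT PhiF] [PsiB PsiT PsiF] Tg Fh [u [v E]].
have opp_inv (a b : {fraction {poly R}}) : a + b = a - (0 - b) by rewrite sub0r opprK.
have PhiD (a b : {fraction {poly R}}) : Phi (a + b) = Phi a + Phi b.
  have Phi0 : Phi 0 = 0 by rewrite -[X in Phi X](subrr 0) PhiB subrr.
  by rewrite opp_inv !PhiB Phi0 -opp_inv.
have PsiD (a b : {fraction {poly R}}) : Psi (a + b) = Psi a + Psi b.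
  have Psi0 : Psi 0 = 0 by rewrite -[X in Psi X](subrr 0) PsiB subrr.
  by rewrite opp_inv !PsiB Psi0 -opp_inv.
have [u1 [u2 [Tu1 Fu2 uE]]] := T_decomposition u.
have [v1 [v2 [Tv1 Fv2 vE]]] := T_decomposition v.
(* The difference of the two sides lies in both parts, so it vanishes. *)
exists u1, v1; apply/eqP; rewrite -subr_eq0; apply/eqP/T_part_uniq.
  have -> : Phi u1 - u1 + Psi v1 - v1 = (Phi u1 - u1) - (v1 - Psi v1) by ring.
  by do !apply: T_partB => //; [apply: PhiT|apply: PsiT].
have -> : g - (Phi u1 - u1 + Psi v1 - v1) = (Phi u2 - u2) - (v2 - Psi v2) - h.
  have -> : g = Phi u - u + Psi v - v - h by rewrite -E; ring.
  by rewrite uE vE PhiD PsiD; ring.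
by do !apply: T_free_partB => //; [apply: PhiF|apply: PsiF].
Qed.

End Decomposition.

(** * The shift operators *)

Lemma size_rmorph_inj (A B : nzRingType) (f : {rmorphism {poly A} -> {poly B}}) :
  (forall p, size (f p) = size p) -> injective f.
Proof.
move=> szf p q E; apply/eqP.
by rewrite -subr_eq0 -size_poly_eq0 -szf rmorphB E subrr size_poly0.
Qed.

Section Shifts.
Variable K : fieldType.
Implicit Types (a b c : int) (p q : poly3 K) (u v : rat3 K).

HB.instance Definition _ a :=
  GRing.RMorphism.copy (@shx K a) (comp_poly ('X + (a%:~R)%:P)).

(** The coefficient map of [shift3], isolated to carry its own ring morphism structure. *)
Definition shxy a b (q : {poly {poly K}}) : {poly {poly K}} :=
  (map_poly (@shx K a) q) \Po ('X + ((b%:~R : {poly K})%:P)).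

HB.instance Definition _ a b :=
  GRing.RMorphism.copy (shxy a b)
    (comp_poly ('X + ((b%:~R : {poly K})%:P)) \o map_poly (@shx K a)).

HB.instance Definition _ a b c :=
  GRing.RMorphism.copy (@shift3 K a b c)
    (comp_poly ('X + ((c%:~R : {poly {poly K}})%:P)) \o map_poly (shxy a b)).

Lemma shift3E a b c p :
  shift3 a b c p = map_poly (shxy a b) p \Po ('X + ((c%:~R : {poly {poly K}})%:P)).
Proof. by []. Qed.

(** Reduces identities between shifts to the three variables. *)
Lemma poly3_rmorph_ext (B : nzRingType) (f g : {rmorphism poly3 K -> B}) :
  (forall k, f k%:P%:P%:P = g k%:P%:P%:P) -> f 'X%:P%:P = g 'X%:P%:P ->
  f 'X%:P = g 'X%:P -> f 'X = g 'X -> f =1 g.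
Proof.
move=> fgC fgx fgy fgz; elim/poly_ind=> [|p q IH]; first by rewrite !rmorph0.
rewrite !(rmorphD f, rmorphD g, rmorphM f, rmorphM g) fgz IH; congr (_ + _).
elim/poly_ind: q => [|q r IHq]; first by rewrite !rmorph0.
rewrite polyCD polyCM !(rmorphD f, rmorphD g, rmorphM f, rmorphM g) fgy IHq; congr (_ + _).
elim/poly_ind: r => [|r k IHr]; first by rewrite !rmorph0.
by rewrite !polyCD !polyCM !(rmorphD f, rmorphD g, rmorphM f, rmorphM g) fgx IHr fgC.
Qed.

Lemma shift3C a b c (q : {poly {poly K}}) :
  shift3 a b c q%:P = (shxy a b q)%:P.
Proof. by rewrite shift3E map_polyC comp_polyC. Qed.

Lemma shift3CC a b c (q : {poly K}) : shift3 a b c q%:P%:P = (shx a q)%:P%:P.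
Proof. by rewrite shift3C /shxy map_polyC comp_polyC. Qed.

Lemma shift3_const a b c (k : K) : shift3 a b c k%:P%:P%:P = k%:P%:P%:P.
Proof. by rewrite shift3CC /shx comp_polyC. Qed.

Lemma shift3_x a b c : shift3 a b c 'X%:P%:P = 'X%:P%:P + a%:~R :> poly3 K.
Proof. by rewrite shift3CC /shx comp_polyX !rmorphD !rmorph_int. Qed.

Lemma shift3_y a b c : shift3 a b c 'X%:P = 'X%:P + b%:~R :> poly3 K.
Proof. by rewrite shift3C /shxy map_polyX comp_polyX !rmorphD !rmorph_int. Qed.

Lemma shift3_z a b c : shift3 a b c 'X = 'X + c%:~R :> poly3 K.
Proof. by rewrite shift3E map_polyX comp_polyX !rmorph_int. Qed.

Lemma shift3D a b c a' b' c' p :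
  shift3 a b c (shift3 a' b' c' p) = shift3 (a + a') (b + b') (c + c') p.
Proof.
apply: (@poly3_rmorph_ext _ (shift3 a b c \o shift3 a' b' c')) => [k|||] /=.
- by rewrite !shift3_const.
- by rewrite !shift3_x (rmorphD (shift3 a b c)) (rmorph_int (shift3 a b c)) /= shift3_x -addrA intrD.
- by rewrite !shift3_y (rmorphD (shift3 a b c)) (rmorph_int (shift3 a b c)) /= shift3_y -addrA intrD.
- by rewrite !shift3_z (rmorphD (shift3 a b c)) (rmorph_int (shift3 a b c)) /= shift3_z -addrA intrD.
Qed.

Lemma shift3_0 p : shift3 0 0 0 p = p.
Proof.
apply: (@poly3_rmorph_ext _ (@shift3 K 0 0 0) idfun) => [k|||] /=.
- by rewrite shift3_const.
- by rewrite shift3_x addr0.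
- by rewrite shift3_y addr0.
- by rewrite shift3_z addr0.
Qed.

Lemma shx_Kx_fixed (q : {poly K}) : shx 0 q = q.
Proof. by rewrite /shx mulr0z polyC0 addr0 comp_polyXr. Qed.

Lemma shift3K a b c : cancel (@shift3 K a b c) (shift3 (- a) (- b) (- c)).
Proof. by move=> p; rewrite shift3D !addNr shift3_0. Qed.

Lemma shx_inj a : injective (@shx K a).
Proof. by apply: size_rmorph_inj => p; rewrite size_comp_poly2 ?size_XaddC. Qed.

Lemma size_shxy a b (q : {poly {poly K}}) : size (shxy a b q) = size q.
Proof.
by rewrite size_comp_poly2 ?size_XaddC // size_map_inj_poly ?rmorph0 //; apply: shx_inj.
Qed.

Lemma shxy_inj a b : injective (shxy a b).
Proof. exact/size_rmorph_inj/size_shxy. Qed.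

Lemma size_shift3 a b c p : size (shift3 a b c p) = size p.
Proof.
by rewrite shift3E size_comp_poly2 ?size_XaddC // size_map_inj_poly ?rmorph0 //; apply: shxy_inj.
Qed.

Lemma shift3_eq0 a b c p : (shift3 a b c p == 0) = (p == 0).
Proof. by rewrite -!size_poly_eq0 size_shift3. Qed.

(** The leading coefficient for the lexicographic order with z > y > x. It is multiplicative and
    shift-invariant, which fixes the unit between associated shifts. *)
Definition lead_coef3 p := lead_coef (lead_coef (lead_coef p)).

Lemma lead_coef3_shift a b c p : lead_coef3 (shift3 a b c p) = lead_coef3 p.
Proof.
rewrite /lead_coef3 shift3E lead_coef_comp ?size_XaddC // lead_coefXaddC expr1n mulr1.
rewrite lead_coef_map_inj ?rmorph0 //; last exact: shxy_inj.
rewrite /shxy lead_coef_comp ?size_XaddC // lead_coefXaddC expr1n mulr1.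
rewrite lead_coef_map_inj ?rmorph0 //; last exact: shx_inj.
by rewrite /shx lead_coef_comp ?size_XaddC // lead_coefXaddC expr1n mulr1.
Qed.

Lemma lead_coef3M p q : lead_coef3 (p * q) = lead_coef3 p * lead_coef3 q.
Proof. by rewrite /lead_coef3 !lead_coefM. Qed.

Lemma unit_poly3 p : p \is a GRing.unit -> p = (lead_coef3 p)%:P%:P%:P.
Proof.
rewrite poly_unitE => /andP[/eqP sz U].
have pE := size1_polyC (eq_leq sz).
move: U; rewrite {1}pE coefC /= poly_unitE => /andP[/eqP sz1 U].
have pE1 := size1_polyC (eq_leq sz1).
move: U; rewrite pE1 coefC /= poly_unitE => /andP[/eqP sz2 U].
have pE2 := size1_polyC (eq_leq sz2).
by rewrite pE pE1 pE2 /lead_coef3 !lead_coefC.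
Qed.

Lemma unit_shift3 a b c p : (shift3 a b c p \is a GRing.unit) = (p \is a GRing.unit).
Proof.
apply/idP/idP; last exact: rmorph_unit.
by move/(rmorph_unit (shift3 (- a) (- b) (- c))); rewrite /= shift3K.
Qed.

Lemma irreducible3_shift a b c p : irreducible3 p -> irreducible3 (shift3 a b c p).
Proof.
move=> [p0 [nU irr]]; split; first by rewrite shift3_eq0.
split; first by rewrite unit_shift3.
move=> u v /(congr1 (shift3 (- a) (- b) (- c))); rewrite shift3K rmorphM /= => /irr.
by rewrite !unit_shift3.
Qed.

Lemma irreducible3_prime p : irreducible3 p -> prime_elt p.
Proof.
move=> [p0 [nU irr]]; apply: irreducible_prime => //.
do 3!apply: poly_factorial; exact: field_factorial.
Qed.

(** By irreducibility the quotient is a unit, that is, a constant of K; comparing leading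
    coefficients shows that it is 1. *)
Lemma shift_divides_eq a b c a' b' c' p :
  irreducible3 p -> divides (shift3 a b c p) (shift3 a' b' c' p) ->
  shift3 a b c p = shift3 a' b' c' p.
Proof.
move=> irrp [w E].
have [d0 [nU _]] := irreducible3_shift a b c irrp.
have [_ [_ /(_ _ _ E)[|/unit_poly3 wE]]] := irreducible3_shift a' b' c' irrp.
  by rewrite (negbTE nU).
have := congr1 lead_coef3 E; rewrite lead_coef3M !lead_coef3_shift.
have l0 : lead_coef3 p != 0 by rewrite !lead_coef_eq0; case: irrp.
move=> lE; have w1 : lead_coef3 w = 1 by apply: (mulfI l0); rewrite -lE mulr1.
have {wE}w1 : w = 1 by move: wE; rewrite w1 (polyC1 K) (polyC1 {poly K}).
by move: E; rewrite w1 mulr1 => /esym.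
Qed.

Lemma shiftF_frac a b c p q : q != 0 ->
  shiftF a b c (p%:F / q%:F) = (shift3 a b c p)%:F / (shift3 a b c q)%:F.
Proof.
move=> q0; apply: (@frac_map_cross _ _ (shift3 a b c)).
- by rewrite shift3_eq0; apply: denom_ratioP.
- by rewrite shift3_eq0.
- exact: frac_repr_cross.
Qed.

End Shifts.

(* Otherwise failed unification attempts unfold the polynomial arithmetic. *)
#[local] Opaque shiftF shift3.

(** * Shifts of rational functions and orbits of [d] *)

Section ShiftF.
Variable K : fieldType.
Implicit Types (a b c : int) (d t : poly3 K) (u v l : rat3 K).

Definition shift3_rmorphism a b c : {rmorphism poly3 K -> poly3 K} :=
  (@shift3 K a b c : {rmorphism _ -> _}).

Lemma shift3_neq0 a b c p : p != 0 -> shift3_rmorphism a b c p != 0.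
Proof. by rewrite /= shift3_eq0. Qed.

Lemma shiftFB a b c u v : shiftF a b c (u - v) = shiftF a b c u - shiftF a b c v.
Proof (fraction_mapB (@shift3_neq0 a b c) (@shiftF_frac K a b c) u v).

Lemma shiftFM a b c u v : shiftF a b c (u * v) = shiftF a b c u * shiftF a b c v.
Proof
  (@fraction_mapM _ (shift3_rmorphism a b c) (shiftF a b c) (@shiftF_frac K a b c) u v).

Lemma shiftF_comp a b c a' b' c' u :
  shiftF a b c (shiftF a' b' c' u) = shiftF (a + a') (b + b') (c + c') u.
Proof.
elim/fraction_ind: u => p q q0.
have q1 : shift3 a' b' c' q != 0 by rewrite shift3_eq0.
rewrite (shiftF_frac a' b' c' p q0) (shiftF_frac _ _ _ _ q1).
by rewrite (shiftF_frac _ _ _ p q0) !shift3D.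
Qed.

Lemma shiftFC a b c a' b' c' u :
  shiftF a b c (shiftF a' b' c' u) = shiftF a' b' c' (shiftF a b c u).
Proof. by rewrite 2!shiftF_comp (addrC a) (addrC b) (addrC c). Qed.

Lemma shiftF_000 u : shiftF 0 0 0 u = u.
Proof. by elim/fraction_ind: u => p q q0; rewrite (shiftF_frac _ _ _ p q0) !shift3_0. Qed.

Lemma iter_sigma_x n u : iter n (@sigma_x K) u = shiftF n%:Z 0 0 u.
Proof.
elim: n => [|n IH] /=; first by rewrite shiftF_000.
by rewrite IH /sigma_x shiftF_comp !add0r -intS.
Qed.

Lemma polyCC_neq0 (q : {poly K}) : q != 0 -> q%:P%:P != 0 :> poly3 K.
Proof. by rewrite !polyC_eq0. Qed.

Lemma in_Kx_fixed b c l : in_Kx l -> shiftF 0 b c l = l.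
Proof.
move=> [p [q [q0 ->]]].
by rewrite (shiftF_frac _ _ _ _ (polyCC_neq0 q0)) !shift3CC !shx_Kx_fixed.
Qed.

Lemma in_KxV l : in_Kx l -> in_Kx l^-1.
Proof.
(* For [p = 0] the two polynomials cannot be swapped, but the inverse of 0 is 0. *)
move=> [p [q [q0 ->]]]; have [->|p0] := eqVneq p 0.
  by exists 0, 1; rewrite oner_neq0 !polyC0 tofrac0 !mul0r invr0.
by exists q, p; rewrite p0 invf_div.
Qed.

Lemma yz_summableE u :
  yz_summable u <-> difference_form (shiftF 0 1 0) (shiftF 0 0 1) u.
Proof. by []. Qed.

(** Multiplication by [l] commutes with sigma_y and sigma_z, which fix K(x). *)
Lemma yz_summable_Kx l u : in_Kx l -> yz_summable u -> yz_summable (l * u).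
Proof.
move=> lK /yz_summableE S; apply/yz_summableE.
refine (difference_form_map (S := fun v => l * v) (mulrBr l) _ _ S) => v.
- by rewrite shiftFM (in_Kx_fixed 1 0 lK).
- by rewrite shiftFM (in_Kx_fixed 0 1 lK).
Qed.

Lemma yz_summable_shift a b c u : yz_summable u -> yz_summable (shiftF a b c u).
Proof.
move=> /yz_summableE S; apply/yz_summableE.
exact (difference_form_map (@shiftFB a b c) (@shiftFC a b c 0 1 0) (@shiftFC a b c 0 0 1) S).
Qed.

(** The nonconstant ['X] divides all coefficients of 0. *)
Lemma yz_primitive_neq0 (p : poly3 K) : yz_primitive p -> p != 0.
Proof.
move=> prim; apply/eqP => p0; have := prim 'X; rewrite p0 size_polyX => H.
by have /H : forall i j, 'X %| (0 : poly3 K)`_i`_j by move=> i j; rewrite !coef0 dvdp0.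
Qed.

Lemma fbcdE (b d : poly3 K) (c : {poly {poly K}}) lam :
  fbcd b c d lam = b%:F / (c%:P * d ^+ lam)%:F.
Proof. by rewrite /fbcd tofracM tofracXn. Qed.

(** This is the set [T] of the decomposition; [a] is the exponent of sigma_x. *)
Definition shift_orbit a (d t : poly3 K) := exists n k, t = shift3 a n k d.

Lemma shift_orbit_prime a d t : irreducible3 d -> shift_orbit a d t -> prime_elt t.
Proof. by move=> irr [n [k ->]]; apply/irreducible3_prime/irreducible3_shift. Qed.

Lemma shift_orbit_size a (d t : poly3 K) :
  (1 < size d)%N -> shift_orbit a d t -> (1 < size t)%N.
Proof. by move=> sz [n [k ->]]; rewrite size_shift3. Qed.

Lemma shift_orbit_shift a d b c t :
  shift_orbit a d t -> shift_orbit a d (shift3 0 b c t).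
Proof. by move=> [n [k ->]]; rewrite shift3D add0r; exists (b + n), (c + k). Qed.

Lemma shift_orbit_stable a d b c : irreducible3 d ->
  T_stable (shift_orbit a d) (shiftF 0 b c).
Proof.
move=> irr.
refine (@T_stable_map _ _ (fun t => @shift_orbit_prime a d t irr)
  (shift3_rmorphism 0 b c) (shift3_rmorphism (- 0) (- b) (- c)) (shiftF 0 b c)
  (@shiftF_frac K 0 b c) (@size_shift3 K 0 b c) _ (@shift3K K 0 b c)
  (@shift_orbit_shift a d b c) _).
- by move=> r; exists (shxy 0 b r); apply: shift3C.
- by move=> t; rewrite /= oppr0; apply: shift_orbit_shift.
Qed.

Lemma yz_summable_telescoper (f : rat3 K) : yz_summable f -> has_telescoper f.
Proof.
move=> S; exists [:: 1]; split=> [[|i]|]; last split.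
- exists 1, 1; rewrite oner_neq0; split=> //; by rewrite !polyC1 tofrac1 divr1.
(* Past the end of the list the coefficient is the default 0, which must lie in K(x) too. *)
- exists 0, 1; rewrite oner_neq0 /= nth_nil; split=> //; by rewrite !polyC0 tofrac0 mul0r.
- by exists 0; rewrite oner_neq0.
- by rewrite /apply_op big_ord1 /= mul1r.
Qed.

End ShiftF.

(** * The component of L(f) along one orbit *)

Section Main.
Variables (K : fieldType) (lam : nat) (b d : poly3 K) (c : {poly {poly K}}).
Hypothesis lam_gt0 : (0 < lam)%N.
Hypothesis irr_d : irreducible3 d.
Hypothesis b_neq0 : b != 0.
Hypothesis c_neq0 : c != 0.
Hypothesis size_bd : (size b < size d)%N.
Hypothesis no_x_shift : ~ (exists m : nat, (0 < m)%N /\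
  exists n k : int, shift3 (m%:Z) 0 0 d = shift3 0 n k d).

Lemma shxy_neq0 x y (q : {poly {poly K}}) : q != 0 -> shxy x y q != 0.
Proof. by rewrite -!size_poly_eq0 size_shxy. Qed.

Lemma fbcd_shiftE x y z :
  shiftF x y z (fbcd b c d lam) = (shift3 x y z b)%:F /
    ((shxy x y c)%:P * shift3 x y z d ^+ lam)%:F.
Proof.
have d0 : c%:P * d ^+ lam != 0.
  by rewrite mulf_neq0 ?expf_neq0 ?polyC_eq0 //; case: irr_d.
rewrite fbcdE (shiftF_frac x y z b d0).
by rewrite (rmorphM (shift3_rmorphism K x y z)) rmorphXn /= shift3C.
Qed.

Lemma fbcd_shift_T_part (l : rat3 K) (i : int) : in_Kx l ->
  T_part (shift_orbit i d) (l * shiftF i 0 0 (fbcd b c d lam)).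
Proof.
move=> [p [q [q0 ->]]]; rewrite fbcd_shiftE; apply: T_partZ.
  by rewrite polyC_eq0.
apply: T_part_frac => //.
- by move=> t; apply: shift_orbit_prime.
- exact: shxy_neq0.
- by exists 0, 0.
- by rewrite !size_shift3.
Qed.

Lemma x_shift_orbit_disjoint (i j : nat) :
  i != j -> forall n k, shift3 i%:Z 0 0 d <> shift3 j%:Z n k d.
Proof.
move=> ij n k E.
have [lt|lt|ij'] := ltngtP i j; last by rewrite ij' eqxx in ij.
- apply: no_x_shift; exists (j - i)%N; rewrite subn_gt0; split=> //.
  (* Applying the inverse of the shift with the smaller x-exponent leaves a positive power of
     sigma_x; here n and k also change sides. *)
  exists (- n), (- k).
  have := congr1 (shift3 (- i%:Z) (- n) (- k)) E.
  rewrite !shift3D !addNr !addr0 => ->; rewrite -subzn; last exact: ltnW.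
  by rewrite addrC.
- apply: no_x_shift; exists (i - j)%N; rewrite subn_gt0; split=> //.
  exists n, k.
  have := congr1 (shift3 (- j%:Z) 0 0) E.
  rewrite !shift3D !addNr !add0r => <-; rewrite -subzn; last exact: ltnW.
  by rewrite addrC.
Qed.

Lemma fbcd_shift_T_free_part (l : rat3 K) (i j : nat) : in_Kx l -> i != j ->
  T_free_part (shift_orbit j d) (l * shiftF i%:Z 0 0 (fbcd b c d lam)).
Proof.
(* As [b] is nonzero, [d] has positive degree in z. *)
have sz_d : (1 < size d)%N by apply: leq_ltn_trans size_bd; rewrite size_poly_gt0.
move=> [p [q [q0 ->]]] ij; rewrite fbcd_shiftE; apply: T_free_partZ.
- by move=> t; apply: shift_orbit_prime.
- by move=> t; apply: shift_orbit_size.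
- by rewrite polyC_eq0.
apply: T_free_part_frac.
- by move=> t; apply: shift_orbit_prime.
- by move=> t; apply: shift_orbit_size.
- exact: shxy_neq0.
split; first by rewrite shift3_eq0; case: irr_d.
(* An element of the j-th orbit dividing sigma_x^i(d) would be equal to it. *)
move=> t [n [k ->]] /(shift_divides_eq irr_d)/esym.
exact: x_shift_orbit_disjoint.
Qed.

Lemma telescoper_yz_summable :
  has_telescoper (fbcd b c d lam) -> yz_summable (fbcd b c d lam).
Proof.
set f := fbcd b c d lam => -[l [lK [[j lj0] S]]].
(* A nonzero coefficient cannot be the default value, so [j] indexes a term of the sum. *)
have ltj : (j < size l)%N.
  by rewrite ltnNge; apply: contraNN lj0 => /(nth_default 0) ->.
have sz_d : (1 < size d)%N by apply: leq_ltn_trans size_bd; rewrite size_poly_gt0.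
have [h Fh E] : exists2 h, T_free_part (shift_orbit j d) h &
    apply_op l f = l`_j * shiftF j%:Z 0 0 f + h.
  exists (\sum_(i < size l | i != Ordinal ltj) l`_i * iter i (@sigma_x K) f).
    apply: T_free_part_sum => [t|t|i ij]; [exact: shift_orbit_prime|exact: shift_orbit_size|].
    by rewrite iter_sigma_x; apply: fbcd_shift_T_free_part.
  by rewrite /apply_op (bigD1 (Ordinal ltj)) //= iter_sigma_x.
rewrite E in S; move/yz_summableE in S.
(* All other terms are free of the j-th orbit, so the j-th term alone is summable. *)
have {S} /yz_summableE S := T_part_difference
  (fun t => @shift_orbit_prime K j d t irr_d) (fun t => @shift_orbit_size K j d t sz_d)
  (shift_orbit_stable j 1 0 irr_d) (shift_orbit_stable j 0 1 irr_d)
  (fbcd_shift_T_part j (lK j)) Fh S.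
(* Dividing by [l_j] and shifting back by sigma_x^(-j) recovers [f]. *)
have := yz_summable_shift (- j%:Z) 0 0 (yz_summable_Kx (in_KxV (lK j)) S).
by rewrite (mulKf lj0) shiftF_comp addNr !addr0 shiftF_000.
Qed.

End Main.

Theorem theorem6p1 (K : fieldType) (charK : [pchar K] =i pred0)
  (lam : nat) (b d : poly3 K) (c : {poly {poly K}}) :
  (0 < lam)%N ->
  irreducible3 d ->
  yz_primitive b -> yz_primitive (c%:P) -> yz_primitive d ->
  (size b < size d)%N ->
  ~ (exists m : nat, (0 < m)%N /\
       exists n k : int, shift3 (m%:Z) 0 0 d = shift3 0 n k d) ->
  (has_telescoper (fbcd b c d lam) <-> yz_summable (fbcd b c d lam)).
Proof.
move=> lam0 irr /yz_primitive_neq0 b0 /yz_primitive_neq0 c0 _ sz nox.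
rewrite polyC_eq0 in c0; split; first exact: telescoper_yz_summable.
exact: yz_summable_telescoper.
Qed.
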